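(* Let $G$ be a virtually polycyclic group and $\mu$ a symmetric probability measure on $G$ whose support generates $G$ as a group, such that the $\mu$-random walk on $G$ is Liouville. Then $(G,\mu)$ is algebraically recurrent.
   Context: A $\mu$-random walk is $X_n=\zeta_1\cdots\zeta_n$ with $\zeta_i$ i.i.d. of law $\mu$; it is Liouville if every bounded $\mu$-harmonic function on $G$ is constant (trivial Poisson boundary). $\mathcal{S}_n$ denotes the semigroup generated by $\{X_n,X_{n+1},\ldots\}$, and $(G,\mu)$ is algebraically recurrent if for every $n$, $\mathcal{S}_n=G$ almost surely. Symmetric means $\mu(g)=\mu(g^{-1})$ for all $g$. *)

(* Defs.v *)
From HB Require Import structures.
From mathcomp Require Import all_boot all_order all_algebra.
From mathcomp Require Import all_classical all_reals all_analysis.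

Set Implicit Arguments.
Unset Strict Implicit.
Unset Printing Implicit Defensive.

Import Order.TTheory GRing.Theory Num.Theory.
Local Open Scope classical_set_scope.
Local Open Scope ring_scope.

Section GroupDefs.
Variable G : groupType.

Definition is_subgroup (A : set G) : Prop :=
  A 1%g /\ (forall x y, A x -> A y -> A (x * y^-1)%g).

Definition normal_in (N H : set G) : Prop :=
  N `<=` H /\ (forall h n, H h -> N n -> N (h^-1 * n * h)%g).

Definition gen_subgroup (A : set G) : set G :=
  [set g | forall K, is_subgroup K -> A `<=` K -> K g].

Definition gen_semigroup (A : set G) : set G :=
  [set g | forall K, (forall x y, K x -> K y -> K (x * y)%g) -> A `<=` K -> K g].

(* Hn is normal in H and H / Hn is cyclic: some x in H with every y in H
   lying in a coset x^k Hn, k an integer. *)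
Definition cyclic_quotient (H Hn : set G) : Prop :=
  exists2 x, H x & forall y, H y ->
    exists n : nat, Hn ((x ^+ n)^-1 * y)%g \/ Hn (x ^+ n * y)%g.

Definition polycyclic_subgroup (K : set G) : Prop :=
  exists (k : nat) (H : nat -> set G),
    [/\ H 0%N = K, H k = [set 1%g],
        (forall i, (i <= k)%N -> is_subgroup (H i)) &
        (forall i, (i < k)%N -> normal_in (H i.+1) (H i) /\
                                 cyclic_quotient (H i) (H i.+1))].

Definition finite_index (K : set G) : Prop :=
  exists s : seq G, forall g, exists2 t, t \in s & K (t^-1 * g)%g.

Definition virtually_polycyclic : Prop :=
  exists K : set G, is_subgroup K /\ finite_index K /\ polycyclic_subgroup K.

End GroupDefs.

Section Measures.
Variables (R : realType) (G : groupType).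

Definition prob_on (mu : G -> R) : Prop :=
  (forall g, 0 <= mu g) /\ (\esum_(g in [set: G]) (mu g)%:E = 1)%E.

Definition symmetric_measure (mu : G -> R) : Prop :=
  forall g, mu g = mu (g^-1)%g.

Definition mu_support (mu : G -> R) : set G := [set g | mu g != 0].

(* f is mu-harmonic: f(g) = sum_h mu(h) f(gh) (the series being absolutely
   convergent for bounded f, written as positive minus negative part). *)
Definition harmonic (mu : G -> R) (f : G -> R) : Prop :=
  forall g, ((f g)%:E =
    \esum_(h in [set: G]) (mu h * Num.max (f (g * h)%g) 0)%:E -
    \esum_(h in [set: G]) (mu h * Num.max (- f (g * h)%g) 0)%:E)%E.

Definition bounded_fun (f : G -> R) : Prop := exists M : R, forall g, `|f g| <= M.

Definition liouville (mu : G -> R) : Prop :=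
  forall f : G -> R, bounded_fun f -> harmonic mu f -> forall g h, f g = f h.

(* zeta : nat -> T -> G are i.i.d. steps of law mu (the paper's zeta_{i+1}
   is zeta i here): each zeta i is discrete-measurable and, for every finite
   family of distinct indices, the joint law factorizes as the product of mu. *)
Definition iid_steps d (T : measurableType d) (P : probability T R)
    (zeta : nat -> T -> G) (mu : G -> R) : Prop :=
  (forall i g, measurable (zeta i @^-1` [set g])) /\
  (forall (s : seq nat) (gs : nat -> G), uniq s ->
     P (\bigcap_(i in [set` s]) (zeta i @^-1` [set gs i])) =
     (\prod_(i <- s) mu (gs i))%:E).

Definition rw_pos d (T : measurableType d) (zeta : nat -> T -> G) (n : nat)
    (w : T) : G :=
  (\prod_(i < n) zeta i w)%g.

Definition tail_semigroup d (T : measurableType d) (zeta : nat -> T -> G)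
    (n : nat) (w : T) : set G :=
  gen_semigroup [set rw_pos zeta m w | m in [set m | (n <= m)%N]].

Definition algebraically_recurrent (mu : G -> R) : Prop :=
  forall (d : measure_display) (T : measurableType d) (P : probability T R)
         (zeta : nat -> T -> G),
    iid_steps P zeta mu ->
    forall n : nat, (1 <= n)%N ->
      {ae P, forall w, tail_semigroup zeta n w = [set: G]}.

End Measures.

(* Main.v *)
Require Import Defs.
From HB Require Import structures.
From mathcomp Require Import all_boot all_order all_algebra.
From mathcomp Require Import all_classical all_reals all_analysis.
From mathcomp Require Import lra.

Set Implicit Arguments.
Unset Strict Implicit.
Unset Printing Implicit Defensive.

Import Order.TTheory GRing.Theory Num.Theory.
Import numFieldNormedType.Exports.
Local Open Scope classical_set_scope.
Local Open Scope ring_scope.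

(** Two facts are combined. First, in a virtually polycyclic group there is a d such
that any d elements g_1, ..., g_d admit signs for which the semigroup generated by the
g_i^{+-1} contains 1: if N is normal with cyclic quotient, two elements u, v always yield
a nonempty word u^a v^b in N whose inverse uses the opposite signs, so d doubles at each
step of the series. Second, averaging the walk along an ultrafilter gives, by the
Liouville property, a mean on G that does not depend on the starting point, and it is
invariant under inversion since mu is symmetric.

Fix s in the support of mu and let F(A, x) be the probability that the semigroup
generated by A and the future positions of the walk from x misses s. Remembering only one
far-away position g bounds F(A, x) by the mean of F(A u {g}, g), hence, up to epsilon, by
the average of F(A u {g}, g) and F(A u {g^-1}, g^-1) for some g; iterating, by the average
over all signs of F({g_1^{+-1}, ..., g_i^{+-1}}, g_i^{+-1}). For one choice of signs and
some i, g_i^{+-1} becomes invertible in the semigroup, and then a step equal to s, of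
probability mu(s), produces s. So F <= 1 - c with c > 0 independent of the state, and the
Markov property improves this to F = 0. *)

(** * One-signed relations in virtually polycyclic groups *)

Section Semigroups.
Variable G : groupType.
Implicit Types (A B K N : set G) (g h u v x y : G) (a b : bool).
Local Open Scope group_scope.

Lemma gen_semigroup_sub A : A `<=` gen_semigroup A.
Proof. by move=> g Ag K _; apply. Qed.

Lemma gen_semigroupM A g h :
  gen_semigroup A g -> gen_semigroup A h -> gen_semigroup A (g * h).
Proof. by move=> Ag Ah K KM AK; apply: (KM); [exact: Ag|exact: Ah]. Qed.

Lemma gen_semigroup_min A B :
  A `<=` gen_semigroup B -> gen_semigroup A `<=` gen_semigroup B.
Proof.
by move=> AB g; apply => // x y Bx By; exact: gen_semigroupM.
Qed.

Lemma gen_semigroupS A B : A `<=` B -> gen_semigroup A `<=` gen_semigroup B.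
Proof.
by move=> AB; apply: gen_semigroup_min => g /AB; exact: gen_semigroup_sub.
Qed.

Lemma gen_semigroupX A g n :
  gen_semigroup A g -> gen_semigroup A (g ^+ n.+1).
Proof.
move=> Ag; elim: n => [|n IHn]; first by rewrite expg1.
by rewrite expgS; exact: gen_semigroupM.
Qed.

Definition sgpow b g := if b then g else g^-1.

Lemma sgpowN b g : sgpow (~~ b) g = (sgpow b g)^-1.
Proof. by case: b => //=; rewrite invgK. Qed.

(* [unisigned d K]: any d elements of K satisfy a nontrivial relation, a
   nonempty word equal to 1, in which no element occurs together with its
   inverse. *)
Definition unisigned d K := forall g : nat -> G, (forall i, (i < d)%N -> K (g i)) ->
  exists e : nat -> bool,
    gen_semigroup [set sgpow (e i) (g i) | i in [set i | (i < d)%N]] 1.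

Lemma subgroupV K g : is_subgroup K -> K g -> K g^-1.
Proof. by case=> K1 KB Kg; rewrite -[_^-1]mul1g; exact: KB. Qed.

Lemma subgroupM K g h : is_subgroup K -> K g -> K h -> K (g * h).
Proof.
by move=> sK Kg Kh; rewrite -[h]invgK; apply sK.2 => //; exact: subgroupV.
Qed.

Lemma subgroupX K g n : is_subgroup K -> K g -> K (g ^+ n).
Proof.
move=> sK Kg; elim: n => [|n IHn]; first exact: sK.1.
by rewrite expgS; exact: subgroupM.
Qed.

Lemma sgpow_subgroup K b g : is_subgroup K -> K g -> K (sgpow b g).
Proof. by case: b => // sK; exact: subgroupV. Qed.

Section CyclicQuotient.
Variables K N : set G.
Hypotheses (sK : is_subgroup K) (sN : is_subgroup N) (nNK : normal_in N K).

Lemma lcoset_expg u v n : K u -> K v -> N (u^-1 * v) -> N ((u ^+ n)^-1 * v ^+ n).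
Proof.
move=> Ku Kv Nuv; elim: n => [|n IHn]; first by rewrite !expg0 mulVg; exact: sN.1.
rewrite expgS [v ^+ _]expgS.
(* The new factor is the conjugate by [u ^+ n] of [u^-1 * v], which normality keeps in [N]; the rest
   is the induction hypothesis. *)
rewrite (_ : _ * _ = (u ^+ n)^-1 * (u^-1 * v) * u ^+ n * ((u ^+ n)^-1 * v ^+ n)).
  by apply: subgroupM => //; apply nNK.2 => //; exact: subgroupX.
by rewrite invgM !mulgA mulgK.
Qed.

Lemma lcoset_sgpow x y n : K y ->
  N ((x ^+ n)^-1 * y) \/ N (x ^+ n * y) ->
  exists a, N ((x ^+ n)^-1 * sgpow a y).
Proof.
move=> Ky [Nxy|Nxy]; first by exists true.
exists false => /=.
have := nNK.2 y^-1 _ (subgroupV sK Ky) (subgroupV sN Nxy).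
by rewrite invgM invgK !mulgA mulgV mul1g.
Qed.

(* With u ~ x^n and v ~ x^m modulo N, the word u^-m v^n lies in N; it uses
   each of u, v with a single sign, and its inverse uses the opposite signs. *)
Lemma cyclic_quotient_pair y z : cyclic_quotient K N -> K y -> K z ->
  exists p : G * bool * bool, let: (h, a, b) := p in
    [/\ N h, gen_semigroup [set sgpow a y; sgpow b z] h &
        gen_semigroup [set sgpow (~~ a) y; sgpow (~~ b) z] h^-1].
Proof.
move=> [x Kx cyc] Ky Kz.
have [n /(lcoset_sgpow Ky)[a Nu]] := cyc _ Ky.
have [m /(lcoset_sgpow Kz)[b Nv]] := cyc _ Kz.
set u := sgpow a y in Nu; set v := sgpow b z in Nv.
have [Ku Kv] : K u /\ K v by split; exact: sgpow_subgroup.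
(* If n = 0, then u lies in [N] and serves as the word by itself. Otherwise n > 0 keeps u^-m v^n
   nonempty even when m = 0, as the semigroup contains no empty product. *)
have [|n0] := posnP n.
  move=> n0; move: Nu; rewrite n0 expg0 invg1 mul1g => Nu.
  exists (u, a, true); split => //; first by apply: gen_semigroup_sub; left.
  by apply: gen_semigroup_sub; left; rewrite /= sgpowN.
have Nh : N ((u^-1) ^+ m * v ^+ n).
  have Nu' := lcoset_expg m (subgroupX n sK Kx) Ku Nu.
  have Nv' := lcoset_expg n (subgroupX m sK Kx) Kv Nv.
  have := subgroupM sN (subgroupV sN Nu') Nv'.
  rewrite -!expgnA mulnC invgM invgK mulgA.
  by rewrite mulgK expVgn.
exists (u^-1 ^+ m * v ^+ n, ~~ a, b); rewrite negbK !sgpowN -/u -/v.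
have gX (A : set G) g k h : A g -> gen_semigroup A h ->
    gen_semigroup A (g ^+ k * h) /\ gen_semigroup A (h * g ^+ k).
  case: k => [|k] Ag Ah; first by rewrite expg0 mulg1 mul1g.
  by split; apply: gen_semigroupM => //; apply: gen_semigroupX;
    exact: gen_semigroup_sub.
split => //.
  apply: (gX _ _ _ _ _ _).1; first by left.
  by rewrite -(prednK n0); apply: gen_semigroupX; apply: gen_semigroup_sub; right.
rewrite invgM expVgn invgK -expVgn.
apply: (gX _ _ _ _ _ _).2; first by left.
by rewrite -(prednK n0); apply: gen_semigroupX; apply: gen_semigroup_sub; right.
Qed.

(** A relation in [N] is applied to the words h_i made from the pairs (g_{2i}, g_{2i+1}). Inverting
    h_i flips both signs of its pair, so after substitution each g_j still occurs with one sign
    only. *)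
Lemma unisigned_cyclic_quotient d :
  cyclic_quotient K N -> unisigned d N -> unisigned d.*2 K.
Proof.
move=> cyc uN g Kg.
have /choice[p Pp] : forall i, exists p : G * bool * bool, (i < d)%N ->
   let: (h, a, b) := p in
    [/\ N h, gen_semigroup [set sgpow a (g i.*2); sgpow b (g i.*2.+1)] h &
        gen_semigroup [set sgpow (~~ a) (g i.*2); sgpow (~~ b) (g i.*2.+1)] h^-1].
  move=> i; have [id|_] := ltnP i d; last by exists (1, true, true).
  have [||p Pp] := @cyclic_quotient_pair (g i.*2) (g i.*2.+1) cyc.
  - by apply: Kg; rewrite ltn_double.
  - by apply: Kg; rewrite ltn_Sdouble.
  - by exists p.
have [i id|e he] := uN (fun i => (p i).1.1).
  by have := Pp i id; case: (p i) => [[h a] b] [].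
(* If the relation uses h_i, the pair keeps its signs a and b; if it uses h_i^-1, both are
   negated. *)
pose e' k := e k./2 (+) ~~ (if odd k then (p k./2).2 else (p k./2).1.2).
exists e'; apply: (gen_semigroup_min _ he) => _ [i /= id <-].
have e'0 : e' i.*2 = e i (+) ~~ (p i).1.2 by rewrite /e' odd_double doubleK.
have e'1 : e' i.*2.+1 = e i (+) ~~ (p i).2.
  by rewrite /e' /= odd_double /= uphalf_double.
have := Pp i id; case: (p i) e'0 e'1 => [[h a] b] /= e'0 e'1 [_ h1 h2].
case: (e i) e'0 e'1 => /= e'0 e'1; last first.
- apply: (gen_semigroupS _ h2) => _ /= [] ->.
  + by exists i.*2; rewrite ?e'0//= ltn_double.
  + by exists i.*2.+1; rewrite ?e'1//= ltn_Sdouble.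
- apply: (gen_semigroupS _ h1) => _ /= [] ->.
  + by exists i.*2; rewrite ?e'0 ?negbK//= ltn_double.
  + by exists i.*2.+1; rewrite ?e'1 ?negbK//= ltn_Sdouble.
Qed.

End CyclicQuotient.

Lemma unisigned1 : unisigned 1 [set 1].
Proof.
move=> g g1; exists (fun=> true); apply: gen_semigroup_sub.
by exists 0%N => //=; apply: g1.
Qed.

Lemma unisigned_polycyclic K : polycyclic_subgroup K -> exists d, unisigned d K.
Proof.
move=> [k [H [H0 Hk sH qH]]]; rewrite -H0.
(* The series is climbed from its trivial bottom term [H k]. *)
suff: forall i, (i <= k)%N -> exists d, unisigned d (H (k - i)%N).
  by move=> /(_ k (leqnn k)); rewrite subnn.
elim=> [_|i IHi ik]; first by rewrite subn0 Hk; exists 1%N; exact: unisigned1.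
have [d ud] := IHi (ltnW ik); exists d.*2.
have lt : (k - i.+1 < k)%N by rewrite ltn_subrL /= (leq_ltn_trans _ ik).
have := qH _ lt; rewrite subnSK// => -[nH cH].
by apply: unisigned_cyclic_quotient cH ud => //; apply: sH; exact: leq_subr.
Qed.

Lemma finite_index_expg K g : is_subgroup K -> finite_index K ->
  exists n, K (g ^+ n.+1).
Proof.
move=> sK [s sP].
have /choice[t tP] i : exists t, t \in s /\ K (t^-1 * g ^+ i).
  by have [t ts Kt] := sP (g ^+ i); exists t.
(* Pigeonhole: among more powers of g than coset representatives, two share a coset, and their
   quotient lies in [K]. *)
have /(uniqPn 1)[i [j [ij]]] : ~~ uniq (map t (iota 0 (size s).+1)).
  apply/negP => ut; have H := @uniq_leq_size _ _ s ut.
  suff: ((size s).+1 <= size s)%N by rewrite ltnn.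
  rewrite -{1}(size_iota 0 (size s).+1) -(size_map t); apply: H.
  by move=> _ /mapP[i _ ->]; exact: (tP i).1.
rewrite size_map size_iota => js.
have is_ := ltn_trans ij js.
rewrite !(nth_map 0%N) ?size_iota// !nth_iota// !add0n => tij.
exists (j - i).-1; rewrite prednK ?subn_gt0//.
have := subgroupM sK (subgroupV sK (tP i).2) (tP j).2.
by rewrite tij invgM invgK mulgA mulgK -{1}(subnKC (ltnW ij)) expgnDr mulKg.
Qed.

Lemma unisigned_finite_index K d : is_subgroup K -> finite_index K ->
  unisigned d K -> unisigned d [set: G].
Proof.
move=> sK fK uK g _.
have /choice[n nP] i := finite_index_expg (g i) sK fK.
have [//|e he] := uK (fun i => g i ^+ (n i).+1).
exists e; apply: (gen_semigroup_min _ he) => _ [i /= id <-].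
have -> : sgpow (e i) (g i ^+ (n i).+1) = sgpow (e i) (g i) ^+ (n i).+1.
  by case: (e i) => //=; rewrite expVgn.
by apply: gen_semigroupX; apply: gen_semigroup_sub; exists i.
Qed.

Lemma unisigned_virtually_polycyclic :
  virtually_polycyclic G -> exists d, unisigned d [set: G].
Proof.
move=> [K [sK [fK pK]]]; have [d ud] := unisigned_polycyclic pK.
by exists d; exact: unisigned_finite_index ud.
Qed.

Lemma gen_semigroup_symmetric A : (forall g, A g -> A g^-1) ->
  (exists g, A g) -> gen_subgroup A = [set: G] -> gen_semigroup A = [set: G].
Proof.
move=> AV [g0 Ag0] gA; apply/seteqP; split => // g _.
have : gen_subgroup A g by rewrite gA.
apply; last exact: gen_semigroup_sub.
have gV x : gen_semigroup A x -> gen_semigroup A x^-1.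
  move=> /(_ [set y | gen_semigroup A y^-1]); apply => [y z Ay Az|y /AV].
    by rewrite /= invgM; exact: gen_semigroupM.
  exact: gen_semigroup_sub.
split=> [|x y Ax Ay]; last by apply: gen_semigroupM => //; exact: gV.
rewrite -(mulgV g0); apply: gen_semigroupM; last apply: gV;
  exact: gen_semigroup_sub.
Qed.

(** Finite words over a countable alphabet are countable. The enumeration [e] of G will turn sums
    over G into series and allow countable intersections of almost sure events. *)
Lemma countable_gen_semigroup A : countable A -> gen_semigroup A = [set: G] ->
  exists e : nat -> G, forall g, exists n, e n = g.
Proof.
move=> /countable_injP[f finj] gA.
pose a n := xget 1 [set x | A x /\ f x = n].
have aP x : A x -> a (f x) = x.
  move=> Ax; apply: finj; rewrite ?inE//; first last.
    by case: (xgetPex 1 (ex_intro (fun y => A y /\ f y = f x) x (conj Ax erefl))).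
  by case: (xgetPex 1 (ex_intro (fun y => A y /\ f y = f x) x (conj Ax erefl))).
pose e n := if unpickle n is Some l then \prod_(i <- (l : seq nat)) a i else 1.
exists e => g.
have : gen_semigroup A g by rewrite gA.
have eP l : e (pickle (l : seq nat)) = \prod_(i <- l) a i by rewrite /e pickleK.
have eE n : exists l, e n = \prod_(i <- (l : seq nat)) a i.
  by rewrite /e; case: unpickle => [l|]; [exists l|exists [::]; rewrite big_nil].
move=> /(_ (range e)) [_ _ [m _ <-] [n _ <-]|x Ax|n _ <-]; last by exists n.
  have [[l ->] [l' ->]] := (eE m, eE n).
  by exists (pickle (l ++ l')); rewrite ?eP ?big_cat.
by exists (pickle [:: f x]); rewrite ?eP ?big_seq1 ?aP.
Qed.

End Semigroups.

(** * Averages with respect to a discrete probability *)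

Lemma le_esumZl (R : realType) (T : choiceType) (c : R) (a : T -> \bar R) :
  0 <= c -> (forall x, 0 <= a x)%E ->
  (\esum_(x in [set: T]) (c%:E * a x) <= c%:E * \esum_(x in [set: T]) a x)%E.
Proof.
move=> c0 a0; apply: ge_ereal_sup => _ [X [finX _]] <-.
rewrite -ge0_mule_fsumr//; apply: lee_wpmul2l; first by rewrite lee_fin.
by apply: ereal_sup_ubound; exists X.
Qed.

Lemma esumZl (R : realType) (T : choiceType) (c : R) (a : T -> \bar R) :
  0 <= c -> (forall x, 0 <= a x)%E ->
  (\esum_(x in [set: T]) (c%:E * a x) = c%:E * \esum_(x in [set: T]) a x)%E.
Proof.
move=> c0 a0; apply/eqP; rewrite eq_le le_esumZl//=.
have [->|cn0] := eqVneq c 0; first by rewrite mul0e esum_ge0// => x _; rewrite mul0e.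
have cp : 0 < c by rewrite lt_neqAle eq_sym cn0.
(* The reverse inequality is the first one applied with the factor c^-1. *)
rewrite -[X in (_ <= X)%E]mul1e -(mulfV cn0) EFinM -muleA.
apply: lee_wpmul2l; first by rewrite lee_fin.
have -> : \esum_(x in [set: T]) a x =
    \esum_(x in [set: T]) ((c^-1)%:E * (c%:E * a x))%E.
  by apply: eq_esum => x _; rewrite muleA -EFinM mulVf// mul1e.
apply: le_esumZl; first by rewrite invr_ge0.
by move=> x; apply: mule_ge0 => //; rewrite lee_fin.
Qed.

Section Mean.
Variables (R : realType) (G : groupType) (mu : G -> R).
Hypothesis mu_prob : prob_on mu.
Implicit Types f g : G -> R.

Definition nnbounded (T : Type) (f : T -> R) :=
  exists M, forall z, 0 <= f z <= M.

(** [fine] sends an infinite sum to 0; for [nnbounded] functions the sum is finite and [esum_meanE]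
    recovers it. *)
Definition mean f : R := fine (\esum_(z in [set: G]) (mu z * f z)%:E).

Let mu_ge0 z : 0 <= mu z. Proof. exact: mu_prob.1. Qed.

Lemma nnbounded_ge0 (T : Type) (f : T -> R) z : nnbounded f -> 0 <= f z.
Proof. by case=> M /(_ z)/andP[]. Qed.

Lemma esum_mean_le f M : (forall z, 0 <= f z <= M) ->
  (\esum_(z in [set: G]) (mu z * f z)%:E <= M%:E)%E.
Proof.
move=> fM; have M0 : 0 <= M by have /andP[] := fM 1%g; exact: le_trans.
rewrite -[leRHS]mule1 -mu_prob.2 -esumZl//.
apply: le_esum => z _; rewrite -EFinM lee_fin mulrC ler_wpM2r//.
by case/andP: (fM z).
Qed.

Lemma esum_meanE f : nnbounded f ->
  \esum_(z in [set: G]) (mu z * f z)%:E = (mean f)%:E.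
Proof.
move=> [M fM]; rewrite fineK// ge0_fin_numE.
  by rewrite (le_lt_trans (esum_mean_le fM))// ltry.
by apply: esum_ge0 => z _; rewrite lee_fin mulr_ge0//; case/andP: (fM z).
Qed.

Lemma mean_ge0 f : (forall z, 0 <= f z) -> 0 <= mean f.
Proof.
by move=> f0; apply/fine_ge0/esum_ge0 => z _; rewrite lee_fin mulr_ge0.
Qed.

Lemma mean_le f M : (forall z, 0 <= f z <= M) -> mean f <= M.
Proof.
move=> fM; rewrite -lee_fin -esum_meanE; last by exists M.
exact: esum_mean_le.
Qed.

Lemma nnbounded_mean (T : Type) (k : T -> G -> R) M :
  (forall x z, 0 <= k x z <= M) -> forall x, 0 <= mean (k x) <= M.
Proof.
move=> kM x; rewrite mean_le// andbT.
by apply: mean_ge0 => z; case/andP: (kM x z).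
Qed.

Lemma le_mean f g : (forall z, f z <= g z) -> (forall z, 0 <= f z) -> nnbounded g ->
  mean f <= mean g.
Proof.
move=> fg f0 [M gM]; rewrite -lee_fin -!esum_meanE; last 2 first.
  by exists M.
  by exists M => z; rewrite f0/= (le_trans (fg z))//; case/andP: (gM z).
by apply: le_esum => z _; rewrite lee_fin ler_wpM2l.
Qed.

Lemma mean_cst c : 0 <= c -> mean (fun=> c) = c.
Proof.
move=> c0; apply: EFin_inj; rewrite -esum_meanE; last by exists c => z; rewrite c0 lexx.
under eq_esum do rewrite mulrC EFinM.
by rewrite esumZl ?mu_prob.2 ?mule1// => z; rewrite lee_fin.
Qed.

Lemma nnboundedD (T : Type) (f g : T -> R) :
  nnbounded f -> nnbounded g -> nnbounded (fun z => f z + g z).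
Proof.
move=> [M fM] [M' gM]; exists (M + M') => z.
case/andP: (fM z) => *; case/andP: (gM z) => *.
by rewrite addr_ge0// lerD.
Qed.

Lemma nnboundedZ (T : Type) (f : T -> R) c : 0 <= c -> nnbounded f ->
  nnbounded (fun z => c * f z).
Proof.
move=> c0 [M fM]; exists (c * M) => z.
by case/andP: (fM z) => *; rewrite mulr_ge0// ler_wpM2l.
Qed.

Lemma nnbounded_comp (T T' : Type) (f : T -> R) (h : T' -> T) :
  nnbounded f -> nnbounded (fun z => f (h z)).
Proof. by move=> [M fM]; exists M => z. Qed.

Lemma nnbounded_sum (I T : Type) (r : seq I) (f : I -> T -> R) :
  (forall i, nnbounded (f i)) -> nnbounded (fun z => \sum_(i <- r) f i z).
Proof.
move=> fb; elim: r => [|i r IHr].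
  by exists 0 => z; rewrite big_nil lexx.
have [M HM] := nnboundedD (fb i) IHr.
by exists M => z; rewrite big_cons.
Qed.

Lemma meanD f g : nnbounded f -> nnbounded g ->
  mean (fun z => f z + g z) = mean f + mean g.
Proof.
move=> fb gb; apply: EFin_inj; rewrite EFinD -!esum_meanE//; last exact: nnboundedD.
rewrite -esumD; last 2 first.
  by move=> z _; rewrite lee_fin mulr_ge0// nnbounded_ge0.
  by move=> z _; rewrite lee_fin mulr_ge0// nnbounded_ge0.
by apply: eq_esum => z _; rewrite mulrDr.
Qed.

Lemma meanZ c f : 0 <= c -> nnbounded f -> mean (fun z => c * f z) = c * mean f.
Proof.
move=> c0 fb; apply: EFin_inj; rewrite EFinM -!esum_meanE//; last exact: nnboundedZ.
rewrite -esumZl//; last first.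
  by move=> z; rewrite lee_fin mulr_ge0// nnbounded_ge0.
by apply: eq_esum => z _; rewrite -EFinM mulrCA.
Qed.

Lemma mean_sum (I : Type) (r : seq I) (f : I -> G -> R) :
  (forall i, nnbounded (f i)) ->
  mean (fun z => \sum_(i <- r) f i z) = \sum_(i <- r) mean (f i).
Proof.
move=> fb; elim: r => [|i r IHr].
  rewrite big_nil -[RHS](mean_cst (lexx 0)); congr mean.
  by apply/funext => z; rewrite big_nil.
rewrite big_cons -IHr -meanD//; last exact: nnbounded_sum.
by congr mean; apply/funext => z; rewrite big_cons.
Qed.

(** A finite set [X] carries the mean of [f] up to e/2, and on [X] only a finite sum has to
    converge. The argument works along any filter, in particular along the ultrafilter used
    below. *)
Lemma fatou_mean (I : Type) (F : set_system I) (FF : Filter F)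
    (f_ : I -> G -> R) f M e : (forall i z, 0 <= f_ i z <= M) -> nnbounded f ->
  (forall z, f_ i z @[i --> F] --> f z) -> 0 < e ->
  \forall i \near F, mean f - e <= mean (f_ i).
Proof.
move=> f_M fb f_f e0.
have e20 : 0 < e / 2 by rewrite divr_gt0.
have [] := @ub_ereal_sup_adherent R _ _ e20
    (etrans (congr1 (mem fin_num) (esum_meanE fb)) erefl).
move=> _ [X [finX _] <-]; rewrite -/(esum _ _) esum_meanE// fsumEFin// -EFinB lte_fin => ltX.
pose r : seq G := finmap.enum_fset (fset_set X).
have cvgX : \sum_(z <- r) mu z * f_ i z @[i --> F] -->
    \sum_(z <- r) mu z * f z.
  apply: cvg_big; first exact: add_continuous.
  by move=> z _; apply: cvgMr; exact: f_f.
have : \sum_(z <- r) mu z * f z - e / 2 < \sum_(z <- r) mu z * f z.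
  by rewrite ltrBlDr ltrDl.
move=> /(cvgr_ge _ cvgX); apply: filterS => i; rewrite -!fsbig_finite//= => Hi.
have : \sum_(z \in X) mu z * f_ i z <= mean (f_ i).
  rewrite -lee_fin -esum_meanE; last by exists M.
  by rewrite -fsumEFin//; apply: ereal_sup_ubound; exists X.
by apply: le_trans; lra.
Qed.

(** Bounded convergence: the Fatou bound for [f_] gives one side, and for [M - f_] the other. *)
Lemma cvg_mean (I : Type) (F : set_system I) (FF : ProperFilter F)
    (f_ : I -> G -> R) f M : (forall i z, 0 <= f_ i z <= M) ->
  (forall z, f_ i z @[i --> F] --> f z) -> mean (f_ i) @[i --> F] --> mean f.
Proof.
move=> f_M f_f.
have fM z : 0 <= f z <= M.
  apply/andP; split.
    by apply: (cvgr_to_ge (f_f z)); apply: nearW => i; case/andP: (f_M i z).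
  by apply: (cvgr_to_le (f_f z)); apply: nearW => i; case/andP: (f_M i z).
have M0 : 0 <= M by have /andP[] := fM 1%g; exact: le_trans.
have meanB g : (forall z, 0 <= g z <= M) -> mean (fun z => M - g z) = M - mean g.
  move=> gM; apply/eqP; rewrite eq_sym subr_eq addrC -meanD.
  - rewrite (_ : (fun z => _) = fun=> M); first by rewrite mean_cst.
    by apply/funext => z; rewrite addrC subrK.
  - by exists M.
  - by exists M => z; have := gM z; lra.
apply/cvgrPdist_le => e e0; have FF' : Filter F by exact: filter_filter.
have H1 := fatou_mean FF' f_M (ex_intro _ M fM) f_f e0.
have H2 : \forall i \near F, mean (fun z => M - f z) - e <= mean (fun z => M - f_ i z).
  apply: (@fatou_mean _ _ FF' _ _ M) => //.
  - by move=> i z; have := f_M i z; lra.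
  - by exists M => z; have := fM z; lra.
  - by move=> z; apply: cvgB; [exact: cvg_cst|exact: f_f].
apply: filterS2 H1 H2 => i; rewrite !meanB// => h1 h2.
by rewrite ler_distl; lra.
Qed.

Lemma mean_exchange (k : G -> G -> R) M : (forall x y, 0 <= k x y <= M) ->
  mean (fun x => mean (fun y => k x y)) = mean (fun y => mean (fun x => k x y)).
Proof.
have esumE (h : G -> G -> R) : (forall x y, 0 <= h x y <= M) ->
    \esum_(p in [set: G * G]) (mu p.1 * (mu p.2 * h p.1 p.2))%:E =
    (mean (fun x => mean (h x)))%:E.
  move=> hM; rewrite -esum_meanE; last first.
    by exists M; exact: nnbounded_mean.
  under [RHS]eq_esum => x _.
    rewrite EFinM -esum_meanE; last by exists M; exact: hM.
    rewrite -esumZl//; last first.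
      by move=> z; rewrite lee_fin mulr_ge0//; case/andP: (hM x z).
    over.
  rewrite esum_esum; last first.
    by move=> x y _ _; rewrite -EFinM lee_fin !mulr_ge0//; case/andP: (hM x y).
  rewrite (_ : _ `*`` _ = [set: G * G]); first exact: eq_esum.
  by apply/seteqP; split.
move=> kM; apply: EFin_inj; rewrite -!esumE//.
rewrite (@reindex_esum _ _ _ [set: G * G] [set: G * G] (fun p => (p.2, p.1))).
  by apply: eq_esum => p _ /=; rewrite mulrCA.
split => //; first by move=> [x y] [x' y'] _ _ /= [-> ->].
by move=> [x y] _; exists (y, x).
Qed.

Lemma mean_inv f : symmetric_measure mu -> mean (fun z => f z^-1%g) = mean f.
Proof.
move=> musym; rewrite /mean; congr fine.
rewrite [RHS](@reindex_esum _ _ _ [set: G] [set: G] (fun z => z^-1%g)).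
  by apply: eq_esum => z _; rewrite -musym.
split => //; first by move=> x y _ _ /invg_inj.
by move=> x _; exists x^-1%g => //=; rewrite invgK.
Qed.

(** Adding to [f] the indicator of s, whose mean is [mu s], still gives a function bounded by 1. *)
Lemma mean_le_off f (s : G) : (forall z, 0 <= f z <= 1) -> f s = 0 ->
  mean f <= 1 - mu s.
Proof.
move=> f1 fs; rewrite lerBrDr.
have -> : mu s = mean (fun z => (z == s)%:R).
  apply: EFin_inj; rewrite -esum_meanE; last first.
    by exists 1 => z; case: (_ == _); rewrite ler01 lexx.
  rewrite (esumID [set s]); last by move=> z _; rewrite lee_fin mulr_ge0.
  rewrite setTI esum_set1 ?eqxx ?mulr1 ?lee_fin// esum1 ?adde0//.
  by move=> z [_ /= /eqP/negbTE ->]; rewrite mulr0.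
rewrite -meanD; [|by exists 1|]; last first.
  by exists 1 => z; case: (_ == _); rewrite ler01 lexx.
apply: mean_le => z; case: eqP => [->|_]; first by rewrite fs add0r ler01 lexx.
by rewrite addr0.
Qed.

Lemma countable_mu_support : countable (mu_support mu).
Proof.
(* [X n] has mass above 1 - 1/(n+1), so it contains every point of mass more than 1/(n+1). *)
have /choice[X XP] n : exists X : set G, finite_set X /\
    1 - n.+1%:R^-1 < \sum_(z \in X) mu z.
  have [||_ [X [finX _] <-]] := @ub_ereal_sup_adherent R
      [set (\sum_(x \in A) (mu x)%:E)%E | A in fsets [set: G]] n.+1%:R^-1.
  - by rewrite invr_gt0 ltr0n.
  - by rewrite -/(esum _ _) mu_prob.2.
  rewrite -/(esum _ _) mu_prob.2 fsumEFin// -EFinB lte_fin => ltX.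
  by exists X.
apply: (@sub_countable _ _ _ (\bigcup_n X n)); last first.
  by apply: bigcup_countable => // n _; apply: finite_set_countable; exact: (XP n).1.
apply: subset_card_le => z /= muz; apply: contrapT => nX.
have mz : 0 < mu z by rewrite lt_neqAle eq_sym muz mu_ge0.
have [n _ nz] := near_infty_natSinv_lt (PosNum mz).
have {nz} /= nlt := nz n (leqnn n); have [finX ltX] := XP n.
have nXz : ~ X n z by move=> Xz; apply: nX; exists n.
have : (\sum_(x \in X n `|` [set z]) (mu x)%:E <= 1)%E.
  rewrite -mu_prob.2; apply: ereal_sup_ubound; exists (X n `|` [set z]) => //.
  by split => //; rewrite finite_setU; split.
rewrite fsbigU//; last by move=> x [? /= xz]; case: nXz; rewrite -xz.
rewrite fsbig_set1 fsumEFin//= -EFinD lee_fin => /(lt_le_trans (ltrD ltX nlt)).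
by rewrite subrK ltxx.
Qed.

End Mean.

(** * The invariant mean of a Liouville walk *)

Lemma ultra_fmap (I T : Type) (f : I -> T) (U : set_system I) :
  UltraFilter U -> UltraFilter (f @ U).
Proof.
move=> UU; split; first exact: fmap_proper_filter.
move=> G GF UG; apply/seteqP; split => // A GA.
have [//|UnA] := in_ultra_setVsetC (f @^-1` A) UU.
have GnA : G (~` A) by exact: UG.
have G0 : G set0 by rewrite -(setICr A); exact: filterI.
by case: (@filter_not_empty _ G GF).
Qed.

Lemma ultra_cvg_bounded (R : realType) (I : Type) (U : set_system I) (u : I -> R) a b :
  UltraFilter U -> (forall i, a <= u i <= b) -> cvg (u i @[i --> U]).
Proof.
move=> UU uab; have := @segment_compact R a b; rewrite compact_ultra.
move=> /(_ (u @ U) (ultra_fmap u UU))[].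
  by apply: (@filterS _ U _ setT) => [i _|]; [rewrite /= in_itv /= uab|exact: filterT].
by move=> l [_ ul]; apply/cvg_ex; exists l.
Qed.

Section Walk.
Variables (R : realType) (G : groupType) (mu : G -> R).
Hypothesis mu_prob : prob_on mu.
Implicit Types f g : G -> R.

Definition transition f x := mean mu (fun z => f (x * z)%g).

(** Inversion exchanges right and left multiplication, so the inversion invariance of the mean goes
    through this operator. *)
Definition left_transition f x := mean mu (fun z => f (z * x)%g).

Lemma iter_transition_bounded f M j : (forall x, 0 <= f x <= M) ->
  forall x, 0 <= iter j transition f x <= M.
Proof.
move=> fM; elim: j => [//|j IHj] x /=.
exact: (@nnbounded_mean _ _ _ mu_prob _ (fun x z => iter j transition f (x * z)%g)).
Qed.

Lemma nnbounded_iter_transition f j : nnbounded f -> nnbounded (iter j transition f).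
Proof. by move=> [M fM]; exists M; exact: iter_transition_bounded. Qed.

Lemma iter_transitionD f g j : nnbounded f -> nnbounded g ->
  iter j transition (fun x => f x + g x) =
  (fun x => iter j transition f x + iter j transition g x).
Proof.
move=> fb gb; elim: j => [//|j IHj]; apply/funext => x; rewrite !iterS IHj /transition.
by rewrite meanD//; apply: nnbounded_comp; exact: nnbounded_iter_transition.
Qed.

Lemma iter_transition_mono f g j : (forall x, 0 <= f x) -> (forall x, f x <= g x) ->
  nnbounded g -> forall x, iter j transition f x <= iter j transition g x.
Proof.
move=> f0 fg gb; have fb : nnbounded f.
  by have [M gM] := gb; exists M => z; rewrite f0 (le_trans (fg z))//; case/andP: (gM z).
elim: j => [//|j IHj] x /=; apply: le_mean => //.
  by move=> z; apply: nnbounded_ge0; exact: nnbounded_iter_transition.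
by apply: nnbounded_comp; exact: nnbounded_iter_transition.
Qed.

Lemma iter_transition_left_transition f j : nnbounded f ->
  iter j transition (left_transition f) = left_transition (iter j transition f).
Proof.
move=> fb; elim: j => [//|j IHj]; apply/funext => x; rewrite !iterS IHj.
have [M hM] := nnbounded_iter_transition j fb.
rewrite /transition /left_transition.
rewrite (@mean_exchange _ _ _ mu_prob (fun y z => iter j transition f (z * (x * y))%g) M)//.
by congr mean; apply/funext => z; congr mean; apply/funext => y; rewrite mulgA.
Qed.

Lemma nnbounded_left_transition f : nnbounded f -> nnbounded (left_transition f).
Proof.
move=> [M fM]; exists M.
exact: (@nnbounded_mean _ _ _ mu_prob _ (fun x z => f (z * x)%g)).
Qed.

(** A product of i.i.d. steps has the same law in either order: at 1 one step is the same on both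
    sides, and the two operators commute. *)
Lemma iter_transition_1 f j : nnbounded f -> iter j transition f 1%g = iter j left_transition f 1%g.
Proof.
elim: j f => [//|j IHj] f fb; rewrite [X in _ = X _]iterSr -IHj; last exact: nnbounded_left_transition.
rewrite iter_transition_left_transition// iterS /transition /left_transition.
by congr mean; apply/funext => z; rewrite mul1g mulg1.
Qed.

(** Inverting the position turns right steps into left steps by inverse increments, and these have
    the same law by symmetry. *)
Lemma iter_transition_inv f j : symmetric_measure mu -> nnbounded f ->
  iter j transition (fun x => f x^-1%g) 1%g = iter j transition f 1%g.
Proof.
move=> musym fb; rewrite (iter_transition_1 _ fb).
suff -> : iter j transition (fun x => f x^-1%g) = (fun x => iter j left_transition f x^-1%g).
  by rewrite invg1.
elim: j => [//|j IHj]; apply/funext => x; rewrite !iterS IHj /transition /left_transition.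
rewrite -(mean_inv (fun z => iter j left_transition f (z * x^-1)%g) musym).
by congr mean; apply/funext => z; rewrite invgM.
Qed.

(** Time 0 is left out because the later bound on the missing probability concerns only iterates of
    order at least 1. *)
Definition cesaro f n x := n.+1%:R^-1 * \sum_(j < n.+1) iter j.+1 transition f x.

Lemma cesaro_ge_le f n x a b : (forall j, a <= iter j.+1 transition f x <= b) ->
  a <= cesaro f n x <= b.
Proof.
move=> fab; rewrite /cesaro ler_pdivlMl ?ltr0n// ler_pdivrMl ?ltr0n//.
have E c : n.+1%:R * c = \sum_(j < n.+1) c :> R.
  by rewrite sumr_const card_ord mulr_natl.
rewrite !E.
by apply/andP; split; apply: ler_sum => j _; case/andP: (fab j).
Qed.

(** One more step shifts the window of times by one, so all terms but the first and last cancel. *)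
Lemma mean_cesaro f n x : nnbounded f ->
  mean mu (fun z => cesaro f n (x * z)%g) =
  cesaro f n x + n.+1%:R^-1 * (iter n.+2 transition f x - transition f x).
Proof.
move=> fb; rewrite /cesaro meanZ//; last first.
  apply: nnbounded_sum => j.
  by apply: (nnbounded_comp (fun z => x * z)%g); exact: nnbounded_iter_transition.
rewrite mean_sum//; last first.
  by move=> j; apply: (nnbounded_comp (fun z => x * z)%g); exact: nnbounded_iter_transition.
rewrite -mulrDr; congr (_ * _).
rewrite [LHS]big_ord_recr [in RHS]big_ord_recl/=.
by rewrite [X in _ = X + _]addrC addrACA addrN addr0.
Qed.

Section InvariantMean.
Variable U : set_system nat.
Hypotheses (U_ultra : UltraFilter U) (U_infty : \oo `<=` U).

Let U_proper : ProperFilter U. Proof. exact: ultra_proper. Qed.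

Definition ultramean f x : R := lim (cesaro f n x @[n --> U]).

Lemma cvg_ultramean f x : nnbounded f ->
  cesaro f n x @[n --> U] --> ultramean f x.
Proof.
move=> [M fM]; apply: (@ultra_cvg_bounded _ _ _ _ 0 M) => // n.
by apply: cesaro_ge_le => j; exact: iter_transition_bounded.
Qed.

Lemma ultramean_bounded f M : (forall x, 0 <= f x <= M) ->
  forall x, 0 <= ultramean f x <= M.
Proof.
move=> fM x; have fb : nnbounded f by exists M.
have H n := @cesaro_ge_le f n x 0 M (fun j => iter_transition_bounded j.+1 fM x).
apply/andP; split.
  apply: (@cvgr_to_ge _ U U_proper _ _ _ _ (@cvg_ultramean _ x fb)).
  by apply: nearW => n; case/andP: (H n).
apply: (@cvgr_to_le _ U U_proper _ _ _ _ (@cvg_ultramean _ x fb)).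
by apply: nearW => n; case/andP: (H n).
Qed.

Lemma ultraharmonic f x : nnbounded f ->
  mean mu (fun z => ultramean f (x * z)%g) = ultramean f x.
Proof.
move=> fb; have [M fM] := fb.
have H : mean mu (fun z => cesaro f n (x * z)%g) @[n --> U] -->
    mean mu (fun z => ultramean f (x * z)%g).
  apply: (@cvg_mean _ _ _ mu_prob _ _ _ _ _ M) => [n z|z].
    by apply: cesaro_ge_le => j; exact: iter_transition_bounded.
  exact: cvg_ultramean.
have H' : mean mu (fun z => cesaro f n (x * z)%g) @[n --> U] --> ultramean f x + 0.
  under eq_fun do rewrite mean_cesaro//.
  apply: cvgD; first exact: cvg_ultramean.
  (* The boundary terms are at most M/(n+1) in absolute value. Below, [harmonic n] denotes the
     sequence 1/(n+1). *)
  apply: (cvg_trans (cvg_app _ U_infty)).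
  apply: (@squeeze_cvgr _ _ _ _ (fun n => - M * harmonic n) (fun n => M * harmonic n)).
  - apply: nearW => n; rewrite /harmonic !(mulrC _ n.+1%:R^-1).
    have h1 := iter_transition_bounded n.+2 fM x.
    have h2 := iter_transition_bounded 1 fM x; rewrite /= in h2.
    by apply/andP; split; apply: ler_wpM2l; rewrite ?invr_ge0//; lra.
  - by rewrite -(mulr0 (- M)); apply: cvgMr; exact: cvg_harmonic.
  - by rewrite -(mulr0 M); apply: cvgMr; exact: cvg_harmonic.
by rewrite addr0 in H'; exact: (cvg_unique _ H H').
Qed.

Lemma ultramean_const f x : liouville mu -> nnbounded f ->
  ultramean f x = ultramean f 1%g.
Proof.
move=> mu_liouville fb; have [M fM] := fb.
have hM := ultramean_bounded fM.
apply: mu_liouville => [|g].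
  by exists M => y; case/andP: (hM y) => h0 ?; rewrite ger0_norm.
(* The averaged function is nonnegative, so the negative part in the definition of harmonicity
   vanishes. *)
rewrite [X in (_ - X)%E]esum1 ?sube0; last first.
  by move=> z _; rewrite max_r ?mulr0// oppr_le0; case/andP: (hM (g * z)%g).
rewrite -[in LHS]ultraharmonic// -esum_meanE//; last by exists M.
by apply: eq_esum => z _; rewrite max_l//; case/andP: (hM (g * z)%g).
Qed.

Lemma ultramean_inv f : symmetric_measure mu -> nnbounded f ->
  ultramean (fun x => f x^-1%g) 1%g = ultramean f 1%g.
Proof.
move=> musym fb; rewrite /ultramean.
suff -> : (fun n => cesaro (fun x => f x^-1%g) n 1%g) = (fun n => cesaro f n 1%g) by [].
apply/funext => n; rewrite /cesaro; congr (_ * _); apply: eq_bigr => j _.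
exact: iter_transition_inv.
Qed.

Lemma ultrameanD f g x : nnbounded f -> nnbounded g ->
  ultramean (fun y => f y + g y) x = ultramean f x + ultramean g x.
Proof.
move=> fb gb; apply: cvg_lim => //.
rewrite (_ : cesaro _ ^~ x = (fun n => cesaro f n x + cesaro g n x)).
  by apply: cvgD; exact: cvg_ultramean.
apply/funext => n; rewrite /cesaro -mulrDr -big_split/=; congr (_ * _).
by apply: eq_bigr => j _; rewrite -!iterS iter_transitionD.
Qed.

Lemma ultramean_ge f c x : nnbounded f -> (forall j, c <= iter j.+1 transition f x) ->
  c <= ultramean f x.
Proof.
move=> [M fM] cf; apply: (@cvgr_to_ge _ U U_proper _ _ _ _ (@cvg_ultramean f x (ex_intro _ M fM))).
apply: nearW => n.
suff /andP[] : c <= cesaro f n x <= M by [].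
apply: cesaro_ge_le => j; rewrite cf.
by case/andP: (iter_transition_bounded j.+1 fM x).
Qed.

Lemma ultramean_sum (I : Type) (r : seq I) (f : I -> G -> R) x :
  (forall i, nnbounded (f i)) ->
  ultramean (fun y => \sum_(i <- r) f i y) x = \sum_(i <- r) ultramean (f i) x.
Proof.
move=> fb; elim: r => [|i r IHr].
  have /(_ x) : forall x, 0 <= ultramean (fun y => \sum_(i <- [::]) f i y) x <= 0.
    by apply: ultramean_bounded => y; rewrite big_nil lexx.
  by rewrite big_nil => /andP[h1 h2]; apply/eqP; rewrite eq_le h2.
have -> : (fun y => \sum_(j <- i :: r) f j y) =
    (fun y => f i y + \sum_(j <- r) f j y).
  by apply/funext => y; rewrite big_cons.
by rewrite big_cons -IHr -ultrameanD//; exact: nnbounded_sum.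
Qed.

(* The mean [ultramean ^~ 1] is invariant under inversion, so a bound for the
   mean of [f] produces one element working for g and g^-1 at once. *)
Lemma ultramean_symmetrized_le f (e : R) : symmetric_measure mu -> nnbounded f -> 0 < e ->
  exists x, ultramean f 1%g <= 2^-1 * (f x + f x^-1%g) + e.
Proof.
(* If no x worked, f(x) + f(x^-1) would stay below 2(m - e) everywhere, although its mean is 2m,
   where m is the mean of [f]. *)
move=> musym fb e0; apply: contrapT => nex.
have fVb : nnbounded (fun x => f x^-1%g) by apply: nnbounded_comp.
have ltf x : 0 <= f x + f x^-1%g <= 2 * (ultramean f 1%g - e).
  apply/andP; split; first by rewrite addr_ge0// nnbounded_ge0.
  rewrite leNgt; apply/negP => lt; apply: nex; exists x.
  by move: (ultramean f 1%g) (f x) (f x^-1%g) lt => a b c; lra.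
have /andP[_] := ultramean_bounded ltf 1%g.
rewrite ultrameanD// ultramean_inv//.
by move: (ultramean f 1%g) => a; lra.
Qed.

End InvariantMean.

End Walk.

(** * The probability of missing an element of the support *)

(** A word either avoids h or can be split at an occurrence of h; the alternatives u = 1 and v = 1
    stand for empty factors. *)
Lemma gen_semigroupU1 (G : groupType) (B : set G) (h x : G) :
  gen_semigroup (B `|` [set h]) x -> gen_semigroup B x \/
  exists u v, [/\ u = 1%g \/ gen_semigroup (B `|` [set h]) u,
    v = 1%g \/ gen_semigroup (B `|` [set h]) v & x = (u * h * v)%g].
Proof.
set A := B `|` [set h].
have AM1 x' y' : x' = 1%g \/ gen_semigroup A x' -> gen_semigroup A y' ->
    gen_semigroup A (x' * y')%g.
  by case=> [->|Ax Ay]; rewrite ?mul1g//; exact: gen_semigroupM.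
have M1A x' y' : gen_semigroup A x' -> y' = 1%g \/ gen_semigroup A y' ->
    gen_semigroup A (x' * y')%g.
  by move=> Ax [->|Ay]; rewrite ?mulg1//; exact: gen_semigroupM.
move=> /(_ [set x | gen_semigroup A x /\ (gen_semigroup B x \/
  exists u v, [/\ u = 1%g \/ gen_semigroup A u,
    v = 1%g \/ gen_semigroup A v & x = (u * h * v)%g])]) H.
suff [] : gen_semigroup A x /\ (gen_semigroup B x \/
  exists u v, [/\ u = 1%g \/ gen_semigroup A u,
    v = 1%g \/ gen_semigroup A v & x = (u * h * v)%g]) by [].
apply: H => [a b [Aa Ba] [Ab Bb]|y [By|->]]; first split.
- exact: gen_semigroupM.
- case: Ba => [Ba|[u [v [Au Av ->]]]]; last first.
    right; exists u, (v * b)%g; split => //; first by right; exact: AM1.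
    by rewrite !mulgA.
  case: Bb => [Bb|[u [v [Au Av ->]]]]; first by left; exact: gen_semigroupM.
  right; exists (a * u)%g, v; split => //; first by right; exact: M1A.
  by rewrite !mulgA.
- by split; [apply: gen_semigroup_sub; left|left; exact: gen_semigroup_sub].
- split; first by apply: gen_semigroup_sub; right.
  by right; exists 1%g, 1%g; split; [left|left|rewrite mul1g mulg1].
Qed.

(** A relation u h v = 1 that really uses the last letter h gives h^-1 = v u. If u and v are both
    empty, then h^-1 = 1 and the hypothesis suffices. *)
Lemma gen_semigroup_inv_last (G : groupType) (B : set G) (h : G) :
  gen_semigroup (B `|` [set h]) 1%g -> ~ gen_semigroup B 1%g ->
  gen_semigroup (B `|` [set h]) h^-1%g.
Proof.
move=> A1 nB1; have [//|[u [v [Au Av E]]]] := gen_semigroupU1 A1.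
have -> : h^-1%g = (v * u)%g.
  have : (u^-1 * (u * h * v) * v^-1 = h)%g by rewrite !mulgA mulVg mul1g mulgK.
  by rewrite -E mulg1 => <-; rewrite invgM !invgK.
case: Au Av => [->|Au] [->|Av]; rewrite ?mul1g ?mulg1//.
exact: gen_semigroupM.
Qed.

Section Never.
Variables (R : realType) (G : groupType) (mu : G -> R) (s : G).
Hypothesis mu_prob : prob_on mu.
Implicit Types (A B : set G) (x y : G) (Phi Psi : set G -> G -> R).

(* A state of the walk is a pair: set of positions visited so far, current position. *)
Definition walk_step Phi A x : R :=
  mean mu (fun z => Phi (A `|` [set (x * z)%g]) (x * z)%g).

Definition missing A x : R := if `[< gen_semigroup A s >] then 0 else 1.

(* Probability that, starting from the state (A, x), the semigroup generated by
   the visited positions misses s after n more steps. *)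
Definition miss_prob n := iter n walk_step missing.

Lemma walk_step_mono Phi Psi : (forall A x, 0 <= Phi A x <= 1) ->
  (forall A x, 0 <= Psi A x <= 1) -> (forall A x, Phi A x <= Psi A x) ->
  forall A x, walk_step Phi A x <= walk_step Psi A x.
Proof.
move=> Phi1 Psi1 PhiPsi A x; apply: le_mean => // [z|].
  by case/andP: (Phi1 (A `|` [set (x * z)%g]) (x * z)%g).
by exists 1.
Qed.

Lemma walk_step_01 Phi : (forall A x, 0 <= Phi A x <= 1) ->
  forall A x, 0 <= walk_step Phi A x <= 1.
Proof.
move=> Phi1 A x; apply: (@nnbounded_mean _ _ _ mu_prob unit
  (fun=> fun z => Phi (A `|` [set (x * z)%g]) (x * z)%g) 1 _ tt) => _ z.
exact: Phi1.
Qed.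

Lemma missing_anti A B x y : A `<=` B -> missing B y <= missing A x.
Proof.
move=> AB; rewrite /missing; case: asboolP => Bs; case: asboolP => // As.
by exfalso; apply: Bs; exact: gen_semigroupS As.
Qed.

Lemma miss_prob_01 n A x : 0 <= miss_prob n A x <= 1.
Proof.
elim: n A x => [|n IHn] A x; last exact: walk_step_01.
by rewrite /miss_prob /= /missing; case: asboolP; rewrite ?lexx ?ler01.
Qed.

Lemma miss_prob_anti n A B x : A `<=` B -> miss_prob n B x <= miss_prob n A x.
Proof.
elim: n A B x => [|n IHn] A B x AB; first exact: missing_anti.
rewrite /miss_prob !iterS; apply: le_mean => // [z|z|].
- by apply: IHn; exact: setSU.
- by case/andP: (miss_prob_01 n (B `|` [set (x * z)%g]) (x * z)%g).
- by exists 1 => z; exact: miss_prob_01.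
Qed.

Lemma miss_prob_nonincreasing A x : nonincreasing_seq (fun n => miss_prob n A x).
Proof.
apply/nonincreasing_seqP => n; elim: n A x => [|n IHn] A x; last first.
  apply: (@walk_step_mono (miss_prob n.+1) (miss_prob n)) => // *;
    exact: miss_prob_01.
rewrite /miss_prob /= /walk_step; apply: mean_le => // z; apply/andP; split.
  by case/andP: (miss_prob_01 0 (A `|` [set (x * z)%g]) (x * z)%g).
by apply: missing_anti => y; left.
Qed.

Definition miss_limit A x : R := lim (miss_prob n A x @[n --> \oo]).

Lemma cvg_miss_prob A x : miss_prob n A x @[n --> \oo] --> miss_limit A x.
Proof.
apply: nonincreasing_is_cvgn; first exact: miss_prob_nonincreasing.
by exists 0 => _ [n _ <-]; case/andP: (miss_prob_01 n A x).
Qed.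

Lemma miss_limit_le n A x : miss_limit A x <= miss_prob n A x.
Proof.
apply: nonincreasing_cvgn_ge; first exact: miss_prob_nonincreasing.
exact: cvg_miss_prob.
Qed.

Lemma miss_limit_01 A x : 0 <= miss_limit A x <= 1.
Proof.
apply/andP; split; last first.
  by have /andP[_] := miss_prob_01 0 A x; apply: le_trans; exact: miss_limit_le.
apply: (cvgr_to_ge (@cvg_miss_prob A x)).
by apply: nearW => n; case/andP: (miss_prob_01 n A x).
Qed.

Lemma miss_limit_anti A B x : A `<=` B -> miss_limit B x <= miss_limit A x.
Proof.
move=> AB; apply: ler_lim; [exact: cvg_miss_prob|exact: cvg_miss_prob|].
by apply: nearW => n; exact: miss_prob_anti.
Qed.

Lemma miss_limit0 A x : gen_semigroup A s -> miss_limit A x = 0.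
Proof.
move=> As; apply/eqP; rewrite eq_le; case/andP: (miss_limit_01 A x) => -> _.
by rewrite andbT (le_trans (miss_limit_le 0 A x))// /miss_prob/= /missing asboolT.
Qed.

(** The Markov property passes to the limit by bounded convergence. *)
Lemma walk_step_miss_limit : walk_step miss_limit = miss_limit.
Proof.
apply/funext => A; apply/funext => x.
have H : miss_prob n.+1 A x @[n --> \oo] --> walk_step miss_limit A x.
  apply: (@cvg_mean _ _ _ mu_prob _ _ _ _ _ 1) => [n z|z].
    exact: miss_prob_01.
  exact: cvg_miss_prob.
have H' := @cvg_miss_prob A x; rewrite -(cvg_shiftS (fun n => miss_prob n A x)) in H'.
exact: cvg_unique H H'.
Qed.

(** If the next step is s, then y s is visited and s = y^-1 (y s) enters the semigroup. *)
Lemma miss_limit_invertible A y : A y -> gen_semigroup A y^-1%g ->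
  miss_limit A y <= 1 - mu s.
Proof.
move=> Ay AyV; rewrite -walk_step_miss_limit; apply: (mean_le_off mu_prob) => [z|].
  exact: miss_limit_01.
apply: miss_limit0; rewrite -{2}[s](mulKg y); apply: gen_semigroupM.
  by apply: (gen_semigroupS _ AyV) => g; left.
by apply: gen_semigroup_sub; right.
Qed.

Definition visit A g := miss_limit (A `|` [set g]) g.

Lemma visit_01 A g : 0 <= visit A g <= 1. Proof. exact: miss_limit_01. Qed.

(* Only the last visited position is remembered; by monotonicity in A this can only
   increase the probability of missing s. *)
Lemma miss_limit_le_transition j A x :
  miss_limit A x <= iter j.+1 (transition mu) (visit A) x.
Proof.
elim: j A x => [|j IHj] A x.
  by rewrite /= -walk_step_miss_limit.
rewrite iterS -walk_step_miss_limit; apply: le_mean => // [z||]; last 2 first.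
- by move=> z; case/andP: (miss_limit_01 (A `|` [set (x * z)%g]) (x * z)%g).
- by exists 1 => z; apply: iter_transition_bounded => // y; exact: visit_01.
apply: (le_trans (IHj _ _)); apply: iter_transition_mono => //.
- by move=> y; case/andP: (visit_01 (A `|` [set (x * z)%g]) y).
- by move=> y; apply: miss_limit_anti; apply: setSU => g; left.
- by exists 1; exact: visit_01.
Qed.

End Never.

(** * Averaging over signs and the uniform gap below 1 *)

Section MissLimitZero.
Variables (R : realType) (G : groupType) (mu : G -> R) (s : G).
Hypotheses (mu_prob : prob_on mu) (mu_sym : symmetric_measure mu).
Hypothesis mu_liouville : liouville mu.
Implicit Types (A B : set G) (x y : G).

Local Notation F := (miss_limit mu s).

(** Working with a sum over a list of states yields a single g valid for all of them at once, which
    is what lets the same g_i serve every branch of signs. *)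
Lemma miss_limit_symmetrized (L : seq (set G * G)) (e : R) : 0 < e ->
  exists g, \sum_(p <- L) F p.1 p.2 <= 2^-1 *
    (\sum_(p <- L) visit mu s p.1 (sgpow true g) +
     \sum_(p <- L) visit mu s p.1 (sgpow false g)) + e.
Proof.
move=> e0; have [U [U_ultra U_infty]] := @ultraFilterLemma nat \oo _.
have vb (p : set G * G) : nnbounded (visit mu s p.1) by exists 1; exact: visit_01.
have [g Hg] := ultramean_symmetrized_le mu_prob U_ultra mu_sym
  (nnbounded_sum L vb) e0.
exists g; apply: le_trans Hg; rewrite ultramean_sum//.
apply: ler_sum => -[A x] _ /=.
(* By the Liouville property the states, whatever their positions x, are all compared with the mean
   based at 1. *)
rewrite -(ultramean_const mu_prob U_ultra U_infty x mu_liouville (vb (A, x))).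
by apply: ultramean_ge (vb (A, x)) _ => // j; exact: miss_limit_le_transition.
Qed.

(** The average of F over the 2^k choices of signs in forced visits to g_0^{+-1}, ...,
    g_{k-1}^{+-1}. *)
Fixpoint branch_mean k (g : nat -> G) A y : R :=
  if k is k'.+1 then
    let branch b := branch_mean k' (fun i => g i.+1)
      (A `|` [set sgpow b (g 0%N)]) (sgpow b (g 0%N)) in
    2^-1 * (branch true + branch false)
  else F A y.

Lemma branch_mean_le1 k g A y : branch_mean k g A y <= 1.
Proof.
elim: k g A y => [|k IHk] g A y; first by case/andP: (miss_limit_01 s mu_prob A y).
rewrite [branch_mean _ _ _ _]/=.
have H b := IHk (fun i => g i.+1) (A `|` [set sgpow b (g 0%N)]) (sgpow b (g 0%N)).
move: (H true) (H false).
move: (branch_mean _ _ _ _) (branch_mean _ _ _ _) => a b; lra.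
Qed.

(** The induction replaces each state by its two successors, hence the arbitrary list. All depths i
    <= k are covered because the useful depth is known only once [g] is chosen. *)
Lemma exists_branching k (e : R) (L : seq (set G * G)) : 0 < e ->
  exists g, forall i, (i <= k)%N ->
    \sum_(p <- L) F p.1 p.2 <= \sum_(p <- L) branch_mean i g p.1 p.2 + i%:R * e.
Proof.
move=> e0; elim: k L => [|k IHk] L.
  by exists (fun=> 1%g) => i; rewrite leqn0 => /eqP ->; rewrite mul0r addr0.
have [g0 Hg0] := miss_limit_symmetrized L e0.
pose L' b := [seq (p.1 `|` [set sgpow b g0], sgpow b g0) | p <- L].
have [g Hg] := IHk (L' true ++ L' false).
exists (fun i => if i is i'.+1 then g i' else g0) => -[_|i ik].
  by rewrite mul0r addr0.
apply: (le_trans Hg0); have := Hg i ik.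
rewrite !big_cat !big_map [branch_mean i.+1]/= -mulr_sumr big_split.
rewrite -[i.+1]add1n natrD mulrDl mul1r.
have key (X Y c : R) : 0 <= c -> X <= Y + c -> 2^-1 * X + e <= 2^-1 * Y + (e + c).
  by lra.
by apply: key; rewrite mulr_ge0// ltW.
Qed.

(** The branch with signs [e] has weight 2^-(k+1) in the average, and every other branch contributes
    at most its weight. *)
Lemma branch_mean_le k g (e : nat -> bool) A y :
  branch_mean k.+1 g A y <= 1 - 2^-1 ^+ k.+1 *
   (1 - F (A `|` [set sgpow (e i) (g i) | i in [set i | (i < k.+1)%N]])
          (sgpow (e k) (g k))).
Proof.
elim: k g e A y => [|k IHk] g e A y.
  rewrite expr1 (_ : [set _ | _ in _] = [set sgpow (e 0%N) (g 0%N)]); last first.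
    apply/seteqP; split => [_ [[|//] _ <-]//|_ ->].
    by exists 0%N.
  have H b := branch_mean_le1 0 (fun i => g i.+1) (A `|` [set sgpow b (g 0%N)])
    (sgpow b (g 0%N)).
  have key (a b : R) : a <= 1 -> b <= 1 -> 2^-1 * (a + b) <= 1 - 2^-1 * (1 - a).
    by lra.
  case: (e 0%N); first exact: key (H true) (H false).
  by rewrite [X in X <= _]/= addrC; exact: key (H false) (H true).
have setE : A `|` [set sgpow (e i) (g i) | i in [set i | (i < k.+2)%N]] =
  (A `|` [set sgpow (e 0%N) (g 0%N)]) `|`
    [set sgpow (e i.+1) (g i.+1) | i in [set i | (i < k.+1)%N]].
  rewrite -setUA; congr (_ `|` _); apply/seteqP; split => [_ [[|i] /= ik <-]|t].
  - by left.
  - by right; exists i.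
  - by case=> [->|[i ik <-]]; [exists 0%N|exists i.+1].
rewrite setE exprS.
have := IHk (fun i => g i.+1) (fun i => e i.+1)
  (A `|` [set sgpow (e 0%N) (g 0%N)]) (sgpow (e 0%N) (g 0%N)).
have := branch_mean_le1 k.+1 (fun i => g i.+1)
  (A `|` [set sgpow (~~ e 0%N) (g 0%N)]) (sgpow (~~ e 0%N) (g 0%N)).
rewrite -mulrA; generalize (2^-1 ^+ k.+1 * (1 - F ((A `|` [set sgpow (e 0%N) (g 0%N)]) `|`
    [set sgpow (e i.+1) (g i.+1) | i in [set i | (i < k.+1)%N]])
    (sgpow (e k.+1) (g k.+1)))) => q.
have -> : branch_mean k.+2 g A y = 2^-1 *
   (branch_mean k.+1 (fun i => g i.+1) (A `|` [set sgpow (e 0%N) (g 0%N)])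
      (sgpow (e 0%N) (g 0%N)) +
    branch_mean k.+1 (fun i => g i.+1) (A `|` [set sgpow (~~ e 0%N) (g 0%N)])
      (sgpow (~~ e 0%N) (g 0%N))).
  by case: (e 0%N) => //; rewrite addrC.
move: (branch_mean _ _ _ (sgpow (~~ e 0%N) _)) => b.
by move: (branch_mean _ _ _ _) => a; lra.
Qed.

(* A uniform gap below 1 improves itself to 0: [miss_limit <= (1 - c) missing]
   and both sides may be propagated along the walk. *)
Lemma miss_limit_eq0 d : unisigned d [set: G] -> 0 < mu s ->
  forall A x, F A x = 0.
Proof.
move=> ud mus.
(* One branch gains 2^-d mu(s). Half of it is kept as the gap; the other half pays for at most d
   errors of size c/(d+1), where d+1 avoids dividing by 0. *)
pose c := 2^-1 ^+ d * mu s / 2.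
have hd : 0 < 2^-1 ^+ d :> R by rewrite exprn_gt0// invr_gt0.
have c0 : 0 < c by rewrite /c divr_gt0// mulr_gt0.
have gap A x : F A x <= 1 - c.
  apply: (@le_trans _ _ (F set0 x)); first exact: miss_limit_anti.
  have e0 : 0 < c / d.+1%:R by rewrite divr_gt0// ltr0n.
  have [g Hg] := exists_branching d [:: (set0, x)] e0.
  have [//|e he] := ud g.
  pose W i := [set sgpow (e j) (g j) | j in [set j | (j < i)%N]].
  have exW : exists i, `[< gen_semigroup (W i) 1%g >] by exists d; apply/asboolP.
  (* At the first i for which [W i] generates 1, the last letter is needed and therefore invertible.
     The value 0 is excluded since the empty set generates the empty semigroup. *)
  case: (ex_minnP exW) => -[|i] /asboolP Wi Wmin.
    have /(_ set0)[] := Wi; first by [].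
    by move=> t [j].
  have id : (i.+1 <= d)%N by apply: Wmin; apply/asboolP.
  have WS : W i.+1 = W i `|` [set sgpow (e i) (g i)].
    apply/seteqP; split => [_ [j /= ji <-]|t [[j /= ji <-]|->]].
    - by move: ji; rewrite ltnS leq_eqVlt => /orP[/eqP ->|ji]; [right|left; exists j].
    - by exists j => //=; exact: ltnW.
    - by exists i => /=.
  have nWi : ~ gen_semigroup (W i) 1%g.
    by move=> /asboolP /Wmin; rewrite ltnn.
  have Fi : F (W i.+1) (sgpow (e i) (g i)) <= 1 - mu s.
    apply: miss_limit_invertible => //; first by exists i => /=.
    by rewrite WS; apply: gen_semigroup_inv_last => //; rewrite -WS.
  have := Hg _ id; rewrite !big_seq1 => /le_trans; apply.
  have := branch_mean_le i g e set0 x; rewrite set0U -/(W i.+1) => Hb.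
  have hi : 2^-1 ^+ d <= 2^-1 ^+ i.+1 :> R.
    by apply: ler_wiXn2l => //; rewrite ?invr_ge0// invf_le1// ler1n.
  have hi2 : 2^-1 ^+ d * mu s <=
      2^-1 ^+ i.+1 * (1 - F (W i.+1) (sgpow (e i) (g i))).
    by apply: ler_pM; rewrite ?(ltW hd) ?(ltW mus)// lerBrDr addrC -lerBrDr.
  have hi3 : i.+1%:R * (c / d.+1%:R) <= c.
    rewrite mulrCA ger_pMr// ler_pdivrMr ?ltr0n// mul1r ler_nat.
    exact: leq_trans id (leqnSn _).
  have key (q X : R) : q <= X -> 1 - X + q / 2 <= 1 - q / 2 by lra.
  by apply: (le_trans (lerD Hb hi3)); exact: key.
have Fle A x : F A x <= (1 - c) * missing R s A x.
  rewrite /missing; case: asboolP => [As|_]; last by rewrite mulr1.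
  by rewrite mulr0 miss_limit0.
have c1 : 0 <= 1 - c.
  by apply: le_trans (gap set0 1%g); case/andP: (miss_limit_01 s mu_prob set0 1%g).
have Fle_n n A x : F A x <= (1 - c) * miss_prob mu s n A x.
  elim: n A x => [|n IHn] A x; first exact: Fle.
  rewrite -walk_step_miss_limit// /miss_prob iterS -/(miss_prob _ _ _).
  rewrite /walk_step -meanZ//; last by exists 1 => z; exact: miss_prob_01.
  apply: le_mean => // [z|].
    by case/andP: (miss_limit_01 s mu_prob (A `|` [set (x * z)%g]) (x * z)%g).
  by apply: nnboundedZ => //; exists 1 => z; exact: miss_prob_01.
move=> A x; apply/eqP; rewrite eq_le.
have /andP[F0 _] := miss_limit_01 s mu_prob A x; rewrite F0 andbT.
have : F A x <= (1 - c) * F A x.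
  have H : (1 - c) * miss_prob mu s n A x @[n --> \oo] --> (1 - c) * F A x.
    by apply: cvgMr; exact: cvg_miss_prob.
  by apply: (cvgr_to_ge H); apply: nearW => n; exact: Fle_n.
rewrite mulrBl mul1r lerBrDr gerDl => cF.
by rewrite -(pmulr_rle0 _ c0).
Qed.

End MissLimitZero.

(** * Paths of the random walk *)

(** The starting point does not count as visited; only later positions enter the set. *)
Definition walk_state (G : groupType) (x : G) (l : seq G) : set G * G :=
  foldl (fun p g => (p.1 `|` [set (p.2 * g)%g], (p.2 * g)%g)) (set0, x) l.

Lemma walk_state_rcons (G : groupType) (x : G) l g :
  walk_state x (rcons l g) =
  ((walk_state x l).1 `|` [set ((walk_state x l).2 * g)%g], ((walk_state x l).2 * g)%g).
Proof. exact: foldl_rcons. Qed.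

Section Path.
Variables (R : realType) (G : groupType) (mu : G -> R).
Hypothesis mu_prob : prob_on mu.
Variable e : nat -> G.
Hypothesis e_surj : forall g, exists n, e n = g.
Variables (d : measure_display) (T : measurableType d) (P : probability T R).
Variable zeta : nat -> T -> G.
Hypothesis zeta_iid : iid_steps P zeta mu.

Definition steps n (w : T) : seq G := mkseq (zeta ^~ w) n.

Definition cylinder (l : seq G) : set T := [set w | steps (size l) w = l].

Lemma stepsS n w : steps n.+1 w = rcons (steps n w) (zeta n w).
Proof. exact: mkseqS. Qed.

Lemma cylinder_rcons l g :
  cylinder (rcons l g) = cylinder l `&` zeta (size l) @^-1` [set g].
Proof.
rewrite /cylinder size_rcons; apply/seteqP; split => w /=; rewrite stepsS.
  by move=> /rcons_inj[].
by move=> [-> ->].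
Qed.

Lemma measurable_cylinder l : measurable (cylinder l).
Proof.
elim/last_ind: l => [|l g IHl].
  by rewrite (_ : cylinder [::] = setT)//; apply/seteqP; split.
by rewrite cylinder_rcons; apply: measurableI => //; exact: zeta_iid.1.
Qed.

Lemma prob_cylinder l : P (cylinder l) = (\prod_(g <- l) mu g)%:E.
Proof.
have := zeta_iid.2 (iota 0 (size l)) (nth 1%g l) (iota_uniq _ _).
rewrite (big_nth 1%g) /index_iota subn0 => <-; congr (P _).
apply/seteqP; split => w /=.
  move=> Cw i /=; rewrite mem_iota /= => il.
  by rewrite -[in RHS]Cw nth_mkseq.
move=> Hw; apply: (@eq_from_nth _ 1%g); rewrite ?size_mkseq// => i il.
by rewrite nth_mkseq//; apply: (Hw i); rewrite /= mem_iota.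
Qed.

Section Miss.
Variables (s x : G) (N : nat).

Definition missed : set T := [set w | ~ gen_semigroup (walk_state x (steps N w)).1 s].

(** First occurrences in the enumeration: [e] is only surjective, and restricting it to these
    indices makes it a bijection onto G. *)
Let fresh n := e n \notin [seq e i | i <- iota 0 n].

Lemma fresh_bij : set_bij [set n | fresh n] [set: G] e.
Proof.
split => // [i j /set_mem /= fi /set_mem /= fj ij|g _].
  have lt i' j' : fresh j' -> e i' = e j' -> (j' <= i')%N.
    move=> fj' E; rewrite leqNgt; apply/negP => lt'.
    by move/negP: fj'; apply; rewrite -E; apply/mapP; exists i'; rewrite ?mem_iota.
  by apply/eqP; rewrite eqn_leq !lt.
have ex : exists n, e n == g by have [n <-] := e_surj g; exists n.
case: (ex_minnP ex) => n /eqP en nmin; exists n => //=.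
apply/negP => /mapP[i]; rewrite mem_iota /= add0n => i_n; rewrite en => /esym/eqP/nmin.
by rewrite leqNgt i_n.
Qed.

(** Induction on the number m of remaining steps: the event is split by the value of the next step
    into countably many longer cylinders, which also gives measurability. *)
Lemma prob_missed_cylinder m l : (size l + m = N)%N ->
  measurable (missed `&` cylinder l) /\
  (P (missed `&` cylinder l) <= ((\prod_(g <- l) mu g) *
     miss_prob mu s m (walk_state x l).1 (walk_state x l).2)%:E)%E.
Proof.
elim: m l => [|m IHm] l lN.
  rewrite addn0 in lN; rewrite /miss_prob /= /missing; case: asboolP => Hs.
    rewrite (_ : missed `&` cylinder l = set0); first by rewrite measure0 mulr0.
    by apply/seteqP; split => // w [/=]; rewrite /cylinder /missed /= lN => + E; rewrite E.
  rewrite (_ : missed `&` cylinder l = cylinder l).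
    by split; [exact: measurable_cylinder|rewrite prob_cylinder mulr1].
  by apply/seteqP; split => w; rewrite /cylinder /missed /= lN; [case|move=> E; split; rewrite ?E].
have [_ fresh_inj fresh_surj] := fresh_bij.
pose F n := if fresh n then missed `&` cylinder (rcons l (e n)) else set0.
have lN' n : (size (rcons l (e n)) + m = N)%N by rewrite size_rcons addSnnS.
have IH n := IHm (rcons l (e n)) (lN' n).
have mF n : measurable (F n).
  by rewrite /F; case: ifP => // _; exact: (IH n).1.
have UF : missed `&` cylinder l = \bigcup_n F n.
  apply/seteqP; split => w.
    move=> [Mw Cw]; have [n /= fn nE] := fresh_surj (zeta (size l) w) I.
    by exists n => //; rewrite /F fn cylinder_rcons.
  move=> [n _]; rewrite /F; case: ifP => // _ [Mw].
  by rewrite cylinder_rcons => -[].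
rewrite UF; split; first exact: bigcup_measurable.
have mUF : measurable (\bigcup_n F n) by exact: bigcup_measurable.
apply: (le_trans (measure_sigma_subadditive P mF mUF (@subset_refl _ _))).
set K := \prod_(g <- l) mu g.
have K0 : 0 <= K by apply: prodr_ge0 => g _; exact: mu_prob.1.
set A := (walk_state x l).1; set y := (walk_state x l).2.
pose a g : \bar R := (K * (mu g * miss_prob mu s m (A `|` [set (y * g)%g]) (y * g)%g))%:E.
have a0 g : (0 <= a g)%E.
  rewrite lee_fin !mulr_ge0//; first exact: mu_prob.1.
  by case/andP: (miss_prob_01 s mu_prob m (A `|` [set (y * g)%g]) (y * g)%g).
apply: (@le_trans _ _ (\sum_(n <oo | fresh n) a (e n))%E).
  rewrite [leRHS]eseries_mkcond; apply: lee_nneseries => // n _.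
  rewrite /F; case: ifP => [fn|]; last by rewrite measure0.
  apply: (le_trans (IH n).2); rewrite walk_state_rcons big_rcons/= lee_fin.
  by rewrite mulrA.
rewrite -esum_pred_image//.
rewrite (_ : e @` _ = [set: G]); last first.
  by apply/seteqP; split => // g _; exact: fresh_surj.
under eq_esum do rewrite /a EFinM.
rewrite esumZl//; last first.
  move=> g; rewrite lee_fin mulr_ge0//; first exact: mu_prob.1.
  by case/andP: (miss_prob_01 s mu_prob m (A `|` [set (y * g)%g]) (y * g)%g).
rewrite esum_meanE//.
by exists 1 => g; exact: miss_prob_01.
Qed.

End Miss.

Lemma walk_state_steps x n w :
  (walk_state x (steps n w)).1 `<=`
    [set (x * rw_pos zeta m w)%g | m in [set m | (1 <= m)%N]] /\
  (walk_state x (steps n w)).2 = (x * rw_pos zeta n w)%g.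
Proof.
elim: n => [|n [IH1 IH2]].
  by split => //=; rewrite /rw_pos big_ord0 mulg1.
have E : (x * rw_pos zeta n w * zeta n w = x * rw_pos zeta n.+1 w)%g.
  by rewrite /rw_pos big_ord_recr /= mulgA.
rewrite stepsS walk_state_rcons IH2 E; split => //= g [/IH1//|->].
by exists n.+1.
Qed.

(** Missing s forever has probability at most [miss_prob] at every time N, which tends to 0. The
    free starting point x will stand for the first steps of the walk. *)
Lemma ae_gen_semigroup s x : (forall A y, miss_limit mu s A y = 0) ->
  {ae P, forall w, gen_semigroup
     [set (x * rw_pos zeta m w)%g | m in [set m | (1 <= m)%N]] s}.
Proof.
move=> lim0.
have HN N : measurable (missed s x N) /\
    (P (missed s x N) <= (miss_prob mu s N set0 x)%:E)%E.
  have := @prob_missed_cylinder s x N N [::] (add0n N).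
  have -> : cylinder [::] = setT by apply/seteqP; split.
  by rewrite setIT big_nil mul1r.
exists (\bigcap_N missed s x N); split.
- by apply: bigcap_measurable => // N _; exact: (HN N).1.
- apply/eqP; rewrite eq_le measure_ge0 andbT.
  have H : (miss_prob mu s N set0 x)%:E @[N --> \oo] --> (0%:E : \bar R).
    by apply: cvg_EFin; [exact: nearW|rewrite -(lim0 set0 x); exact: cvg_miss_prob].
  apply: (@cvge_to_ge _ _ _ _ _ _ _ H); apply: nearW => N.
  apply: le_trans (HN N).2; apply: le_measure; rewrite ?inE.
  + by apply: bigcap_measurable => // n _; exact: (HN n).1.
  + exact: (HN N).1.
  + by move=> w; apply.
- move=> w /= nw N _ sw; apply: nw; apply: gen_semigroupS sw.
  exact: (walk_state_steps x N w).1.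
Qed.

End Path.

(** * Restarting the walk and almost sure recurrence *)

Lemma iid_steps_shift (R : realType) (G : groupType) (mu : G -> R)
    (d : measure_display) (T : measurableType d) (P : probability T R)
    (zeta : nat -> T -> G) n :
  iid_steps P zeta mu -> iid_steps P (fun i => zeta (n + i)%N) mu.
Proof.
move=> [mz pz]; split => [i g|r gs ur]; first exact: mz.
have := pz [seq (n + i)%N | i <- r] (fun j => gs (j - n)%N).
rewrite map_inj_uniq => [/(_ ur)|]; last exact: addnI.
rewrite big_map; under eq_bigr do rewrite addKn.
move=> <-; congr (P _); apply/seteqP; split => w Hw i /=.
  by move=> /mapP[j jr ->]; rewrite addKn; exact: Hw.
move=> ir; have /= := Hw (n + i)%N; rewrite addKn; apply.
by rewrite mem_map//; exact: addnI.
Qed.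

Theorem mainTheorem9 (R : realType) (G : groupType) (mu : G -> R) :
  virtually_polycyclic G ->
  prob_on mu ->
  symmetric_measure mu ->
  gen_subgroup (mu_support mu) = setT ->
  liouville mu ->
  algebraically_recurrent mu.
Proof.
move=> vpG mu_prob mu_sym mu_gen mu_liouville d T P zeta zeta_iid [//|n] _.
have mu_pos s : mu_support mu s -> 0 < mu s.
  by move=> /= ms; rewrite lt_neqAle eq_sym ms mu_prob.1.
have gen : gen_semigroup (mu_support mu) = setT.
  apply: gen_semigroup_symmetric => // [g|]; first by rewrite /mu_support /= -mu_sym.
  (* The support is nonempty because the total mass is 1. *)
  apply: contrapT => nsupp; have := mu_prob.2; rewrite esum1.
    by move=> /eqP; rewrite eqe eq_sym oner_eq0.
  by move=> g _; congr EFin; apply/eqP; apply/negP => /negP ng; apply: nsupp; exists g.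
have [e e_surj] := countable_gen_semigroup (countable_mu_support mu_prob) gen.
have [k uk] := unisigned_virtually_polycyclic vpG.
(* The tail now starts at n+1: its positions are X_n times the positions, at times m >= 1, of the
   walk restarted after n steps. *)
pose zeta' i := zeta (n + i)%N.
have zeta'_iid : iid_steps P zeta' mu by exact: iid_steps_shift.
have rw_posD m w : rw_pos zeta (n + m) w = (rw_pos zeta n w * rw_pos zeta' m w)%g.
  by rewrite /rw_pos big_split_ord.
(* X_n is random, so every fixed starting point [e j] is treated first; countability gives one
   almost sure event for all of them and for all s. *)
have H i j : {ae P, forall w, mu_support mu (e i) -> gen_semigroup
    [set (e j * rw_pos zeta' m w)%g | m in [set m | (1 <= m)%N]] (e i)}.
  have [/mu_pos si|nsi] := pselect (mu_support mu (e i)); last first.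
    by apply: aeW => w /nsi.
  have := ae_gen_semigroup mu_prob e_surj zeta'_iid (e j)
    (miss_limit_eq0 mu_prob mu_sym mu_liouville uk si).
  by apply: filterS => w.
have := ae_foralln (fun i => ae_foralln (H i)).
apply: filterS => w Hw; apply/seteqP; split => // g _.
have : gen_semigroup (mu_support mu) g by rewrite gen.
apply: gen_semigroup_min => s ss.
have [i ei] := e_surj s; have [j ej] := e_surj (rw_pos zeta n w).
rewrite -ei in ss *; apply: gen_semigroupS (Hw i j ss) => _ [m /= m1 <-].
by exists (n + m)%N; rewrite /= ?rw_posD ?ej// -addn1 leq_add2l.
Qed.
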